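(* If $G$ is a finite, simple, connected outerplanar graph without isolated vertices, then $\chi_{ON}(G)\le 4$.
   Context: A CFON coloring of a graph $G=(V,E)$ using $k$ colors is an assignment $C:V(G)\to\{1,\dots,k\}$ such that for every $v\in V(G)$ there exists $i\in\{1,\dots,k\}$ with $|N(v)\cap C^{-1}(i)|=1$, where $N(v)$ is the open neighborhood of $v$. $\chi_{ON}(G)$ is the smallest number of colors required for a CFON coloring of $G$. An outerplanar graph is a planar graph that has a planar drawing in which all vertices belong to the outer face. *)

(* Defs.v *)
From HB Require Import structures.
From mathcomp Require Import all_boot all_order all_algebra.
From mathcomp Require Import all_classical all_reals all_analysis.

Set Implicit Arguments.
Unset Strict Implicit.
Unset Printing Implicit Defensive.

Import Order.TTheory GRing.Theory Num.Theory.
Import numFieldNormedType.Exports.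

Local Open Scope classical_set_scope.
Local Open Scope ring_scope.

(* A finite simple graph is a symmetric irreflexive relation [e] on a         *)
(* finite type.                                                               *)

Section ConflictFree.
Variables (T : finType) (e : rel T).

Definition connected_graph : Prop := forall u v : T, connect e u v.

Definition no_isolated_vertex : Prop := forall v : T, exists u : T, e v u.

Definition open_nbh (v : T) : {set T} := [set u | e v u]%SET.

Definition CFON_coloring (k : nat) (C : {ffun T -> 'I_k}) : bool :=
  [forall v, exists i, #|(open_nbh v :&: C @^-1: [set i])%SET| == 1%N].

Definition CFON_colorable (k : nat) : bool :=
  [exists C : {ffun T -> 'I_k}, CFON_coloring C].

(* An isolated vertex has empty neighborhood and rules out every coloring;    *)
(* otherwise giving each vertex its own color works.                          *)
Lemma CFON_colorable_ex : no_isolated_vertex -> exists k, CFON_colorable k.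
Proof.
move=> niso; exists #|T|; apply/existsP; exists [ffun x => enum_rank x].
apply/forallP => v; have [u evu] := niso v.
apply/existsP; exists (enum_rank u).
rewrite -(cards1 u); apply/eqP/eq_card => w; rewrite !inE ffunE.
rewrite (inj_eq enum_rank_inj).
by case: (eqVneq w u) => [->|_]; rewrite ?evu ?andbF.
Qed.

Definition chi_ON (niso : no_isolated_vertex) : nat :=
  ex_minn (CFON_colorable_ex niso).

End ConflictFree.

Section Outerplanar.
Variable R : realType.

(* The library's norm on [R * R] is the maximum norm; it induces the usual    *)
(* topology and the usual bounded sets of the plane.                          *)
Local Notation plane := (R * R)%type.

Definition simple_arc (A : set plane) (a b : plane) : Prop :=
  exists g : R -> plane,
    [/\ {within `[0, 1], continuous g},
        {in `[0, 1] &, injective g},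
        g 0 = a, g 1 = b & A = g @` `[0, 1]].

Section Drawing.
Variables (T : finType) (e : rel T).
Variables (pos : T -> plane) (arc : T -> T -> set plane).

(* [arc u v] is the closed arc, endpoints included, that represents the edge  *)
(* uv.  By the last two conditions, two distinct edges can only meet at the   *)
(* position of a common endpoint.                                             *)
Record planar_drawing : Prop := PlanarDrawing {
  drawing_pos_inj : injective pos;
  drawing_arc_sym : forall u v, e u v -> arc u v = arc v u;
  drawing_arcP : forall u v, e u v -> simple_arc (arc u v) (pos u) (pos v);
  drawing_vertex : forall u v w, e u v -> arc u v (pos w) -> w = u \/ w = v;
  drawing_edges : forall u v x y, e u v -> e x y ->
    [set u; v]%SET != [set x; y]%SET -> arc u v `&` arc x y `<=` range pos
}.

Definition drawn_set : set plane :=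
  range pos `|` \bigcup_(uv in [set uv : T * T | e uv.1 uv.2]) arc uv.1 uv.2.

Definition face (F : set plane) : Prop :=
  exists2 p, (~` drawn_set) p & F = connected_component (~` drawn_set) p.

Definition outer_face (F : set plane) : Prop := face F /\ ~ bounded_set F.

End Drawing.

(* Faces are open and disjoint from the drawing: a vertex belongs to a face   *)
(* when it lies on the boundary of that face, that is, in its closure.        *)
Definition outerplanar (T : finType) (e : rel T) : Prop :=
  exists (pos : T -> plane) (arc : T -> T -> set plane) (F : set plane),
    [/\ planar_drawing e pos arc,
        outer_face e pos arc F &
        forall v, closure F (pos v)].

End Outerplanar.

(* Main.v *)
Require Import Defs.
From mathcomp Require Import all_boot.

(* Fix a point q of the face and, for each vertex v, a ray from q to v that avoids
   the arcs not incident with v.  Counting modulo 2 how often the direction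
   between points moving along two disjoint curves crosses a fixed half-line gives
   a tournament z on the vertices such that z(a,c)+z(a,d)+z(b,c)+z(b,d) is even for
   all independent edges ab and cd.  This persists when edges are replaced by
   disjoint connected sets, which excludes the K4 and K_{2,3} minors by a parity
   count, and no Jordan curve theorem is needed.

   Excluding these minors yields a recursive decomposition of the graph into
   pieces attached to the rest by one vertex or by two.  For each vertex choose in
   advance a colour d and require exactly one neighbour of colour d.  The states of
   the boundary vertices that extend to a piece always contain one of finitely many
   families, which are stable under the decomposition; stability is a finite check
   with four colours. *)

Set Implicit Arguments.
Unset Strict Implicit.
Unset Printing Implicit Defensive.

(** * Connected vertex sets *)

Section Connectivity.
Variables (T : finType) (e : rel T).
Hypothesis e_sym : symmetric e.

Definition induced (S : {set T}) : rel T := [rel x y | [&& x \in S, y \in S & e x y]].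
Definition conn (S : {set T}) := {in S &, forall x y, connect (induced S) x y}.
Definition comp (S : {set T}) (x : T) : {set T} := [set y | connect (induced S) x y].

Lemma induced_connect_sym S : connect_sym (induced S).
Proof.
by apply: sym_connect_sym => x y; rewrite /induced /= e_sym andbCA.
Qed.

Lemma connect_induced_ind (S : {set T}) (P : T -> Prop) x y :
  (forall u w, u \in S -> w \in S -> e u w -> P u -> P w) ->
  connect (induced S) x y -> P x -> P y.
Proof.
move=> step /connectP[p]; elim: p x => [|w p IHp] x /=; first by move=> _ ->.
by case/andP=> /and3P[xS wS exw] pth lst Px; apply: (IHp w) => //; apply: (step x).
Qed.

Lemma connect_induced_in (S : {set T}) x y :
  connect (induced S) x y -> x \in S -> y \in S.
Proof. exact: (connect_induced_ind (P := fun y => y \in S)). Qed.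

Lemma connect_inducedS (S S' : {set T}) x y :
  S \subset S' -> connect (induced S) x y -> connect (induced S') x y.
Proof.
move=> sub; apply: connect_sub => u w /and3P[uS wS euw].
by apply: connect1; rewrite /induced /= !(subsetP sub).
Qed.

Lemma connect_induced1 (S : {set T}) x y :
  x \in S -> y \in S -> e x y -> connect (induced S) x y.
Proof. by move=> xS yS exy; apply: connect1; rewrite /induced /= xS yS. Qed.

Lemma comp_refl S x : x \in comp S x.
Proof. by rewrite inE. Qed.

Lemma comp_sub (S : {set T}) x : x \in S -> comp S x \subset S.
Proof. by move=> xS; apply/subsetP => y; rewrite inE => /connect_induced_in; apply. Qed.

Lemma comp_step (S : {set T}) x u w :
  x \in S -> u \in comp S x -> w \in S -> e u w -> w \in comp S x.
Proof.
move=> xS uC wS euw; have uS := subsetP (comp_sub xS) _ uC.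
by move: uC; rewrite !inE => /connect_trans; apply; apply: connect_induced1.
Qed.

Lemma conn_comp (S : {set T}) x : x \in S -> conn (comp S x).
Proof.
move=> xS.
have fromx y : y \in comp S x -> connect (induced (comp S x)) x y.
  rewrite inE => xy.
  apply: (connect_induced_ind (P := connect (induced (comp S x)) x) _ xy) => //.
  move=> u w uS wS euw xu.
  have uC : u \in comp S x by apply: connect_induced_in xu (comp_refl _ _).
  apply: connect_trans xu (connect_induced1 uC _ euw).
  exact: comp_step uC wS euw.
move=> y w yC wC; apply: connect_trans (fromx _ wC).
by rewrite induced_connect_sym fromx.
Qed.

Lemma comp_max (S A : {set T}) x : conn A -> x \in A -> A \subset S -> A \subset comp S x.
Proof.
move=> cA xA sAS; apply/subsetP => y yA; rewrite inE.
exact: connect_inducedS (cA _ _ xA yA).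
Qed.

Lemma conn1 x : conn [set x].
Proof. by move=> y w /set1P-> /set1P->. Qed.

Lemma connU (A B : {set T}) a b :
  conn A -> conn B -> a \in A -> b \in B -> e a b -> conn (A :|: B).
Proof.
move=> cA cB aA bB eab.
have sA : A \subset A :|: B := subsetUl _ _.
have sB : B \subset A :|: B := subsetUr _ _.
have froma y : y \in A :|: B -> connect (induced (A :|: B)) a y.
  case/setUP => yin; first exact: connect_inducedS sA (cA _ _ aA yin).
  apply: connect_trans (connect_inducedS sB (cB _ _ bB yin)).
  by apply: connect_induced1; rewrite ?inE ?aA ?bB ?orbT.
move=> y w yU wU; apply: connect_trans (froma _ wU).
by rewrite induced_connect_sym froma.
Qed.

Lemma connU1 (A : {set T}) a b : conn A -> b \in A -> e a b -> conn (a |: A).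
Proof. by move=> cA bA eab; apply: (connU (@conn1 a) cA (set11 a) bA eab). Qed.

Lemma conn_boundary (S A : {set T}) x y :
  connect (induced S) x y -> x \in A -> y \notin A ->
  exists u w, [/\ u \in S, w \in S, u \in A, w \notin A & e u w].
Proof.
move=> xy xA yA.
case: (boolP [exists u, exists w, [&& u \in S, w \in S, u \in A, w \notin A & e u w]]).
  by case/existsP=> u /existsP[w] /and5P[*]; exists u, w.
move=> nex; case/negP: yA; apply: (connect_induced_ind (P := fun y => y \in A) _ xy xA) => u w uS wS euw uA.
apply: contraNT nex => wA; apply/existsP; exists u; apply/existsP; exists w.
by rewrite uS wS uA wA.
Qed.

(** A path from [y] to [x] in [S] has to leave the component of [y], and only the deleted vertex [x]
    lets it do so. *)
Lemma comp_adj (S : {set T}) x y :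
  conn S -> x \in S -> y \in S -> y != x ->
  exists2 u, u \in comp (S :\ x) y & e x u.
Proof.
move=> cS xS yS ynx.
have yS' : y \in S :\ x by rewrite !inE ynx.
have xC : x \notin comp (S :\ x) y.
  by apply/negP => /(subsetP (comp_sub yS')); rewrite !inE eqxx.
have [u [w [uS wS uC wC euw]]] := conn_boundary (cS _ _ yS xS) (comp_refl _ _) xC.
exists u => //; have [<-|wx] := eqVneq w x; first by rewrite e_sym.
by case/negP: wC; apply: comp_step uC _ euw; rewrite // !inE wx.
Qed.

(** Each remaining component of [S :\ x] contains a neighbour of [x], so they all stay joined
    through [x]. *)
Lemma conn_setD_comp (S : {set T}) x y :
  conn S -> x \in S -> y \in S -> y != x -> conn (S :\: comp (S :\ x) y).
Proof.
move=> cS xS yS ynx; set C := comp _ _.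
have yS' : y \in S :\ x by rewrite !inE ynx.
have xC : x \notin C.
  by apply/negP => /(subsetP (comp_sub yS')); rewrite !inE eqxx.
have fromx w : w \in S :\: C -> connect (induced (S :\: C)) x w.
  move=> /setDP[wS wC]; have [->//|wx] := eqVneq w x.
  have wS' : w \in S :\ x by rewrite !inE wx.
  have sub : comp (S :\ x) w \subset S :\: C.
    apply/subsetP => v vw; rewrite inE (subsetP (subsetDl _ _) _ (subsetP (comp_sub wS') _ vw)) andbT.
    apply: contra wC; move: vw; rewrite !inE => wv yv.
    by apply: connect_trans yv _; rewrite induced_connect_sym.
  have [u uw exu] := comp_adj cS xS wS wx.
  apply: (@connect_trans _ _ u).
    by apply: connect_induced1 => //; [apply/setDP | apply: (subsetP sub)].
  apply: connect_inducedS sub _; apply: conn_comp => //; exact: comp_refl.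
move=> u w uS wS; apply: connect_trans (fromx _ wS).
by rewrite induced_connect_sym fromx.
Qed.

End Connectivity.

(** * Even tournaments and the two excluded minors *)

Section Tournament.
Variables (T : finType) (e : rel T) (z : rel T).
Hypothesis e_sym : symmetric e.

(* The model is a drawing on a line with [z a c] meaning that [a] precedes [c]:
   the second condition then says that independent edges do not interleave.
   In general [z] is only a parity of the position of [a] with respect to [c]. *)
Definition even_tournament :=
  (forall a c, a != c -> z a c (+) z c a) /\
  (forall a b c d, e a b -> e c d -> a != c -> a != d -> b != c -> b != d ->
    ~~ (z a c (+) z a d (+) z b c (+) z b d)).

Hypothesis zP : even_tournament.

(** The sum is additive when either path is prolonged by an edge, and it vanishes when one path is
    trivial; disjointness makes the edges involved independent. *)
Lemma even_connect (A B : {set T}) a b c d : [disjoint A & B] ->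
  connect (induced e A) a b -> connect (induced e B) c d ->
  ~~ (z a c (+) z a d (+) z b c (+) z b d).
Proof.
move=> dAB.
have ne u w : u \in A -> w \in B -> u != w.
  by move=> uA wB; apply: contraTneq wB => <-; rewrite (disjointFr dAB uA).
have edge u w : u \in A -> w \in A -> e u w -> connect (induced e B) c d ->
    ~~ (z u c (+) z u d (+) z w c (+) z w d).
  move=> uA wA euw.
  move/(connect_induced_ind (P := fun d => ~~ (z u c (+) z u d (+) z w c (+) z w d))).
  apply; last by case: (z u c); case: (z w c).
  move=> v v' vB v'B evv'.
  have := zP.2 _ _ _ _ euw evv' (ne _ _ uA vB) (ne _ _ uA v'B) (ne _ _ wA vB) (ne _ _ wA v'B).
  by do 6!case: (z _ _).
move=> ab cd.
apply: (connect_induced_ind (P := fun b => ~~ (z a c (+) z a d (+) z b c (+) z b d)) _ ab).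
  by move=> u w uA wA euw; have := edge _ _ uA wA euw cd; do 6!case: (z _ _).
by case: (z a c); case: (z a d).
Qed.

(* The K4 obstruction. *)
Lemma no_triangle_of_neighbours (K : {set T}) b x y w :
  b \notin K -> x \in K -> y \in K -> w \in K -> x != y -> x != w -> y != w ->
  e b x -> e b y -> e b w ->
  connect (induced e (K :\ w)) x y -> connect (induced e (K :\ y)) x w ->
  connect (induced e (K :\ x)) y w -> False.
Proof.
move=> bK xK yK wK xy xw yw ebx eby ebw cxy cxw cyw.
have key u v v' : u \in K -> e b u -> connect (induced e (K :\ u)) v v' ->
    ~~ (z b v (+) z b v' (+) z u v (+) z u v').
  move=> uK ebu; apply: (@even_connect [set b; u]).
    rewrite disjoint_subset; apply/subsetP => s /set2P[]-> ; rewrite !inE ?eqxx //.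
    by rewrite (negPf bK) andbF.
  by apply: connect_induced1; rewrite ?inE ?eqxx ?orbT.
(* In the sum of the three relations every [z b _] occurs twice. What remains is three pairs
   [z u v (+) z v u], each of them true: an odd total. *)
have := key _ _ _ wK ebw cxy; have := key _ _ _ yK eby cxw; have := key _ _ _ xK ebx cyw.
have := zP.1 _ _ xy; have := zP.1 _ _ xw; have := zP.1 _ _ yw.
by do 9!case: (z _ _).
Qed.

(* The K_{2,3} obstruction: the third path joins [a] to [b] through [M]. *)
Lemma no_theta (B M : {set T}) a b x y m :
  a \notin B -> a \notin M -> [disjoint M & B] ->
  x \in B -> y \in B -> b \in B -> x != y -> x != b -> y != b ->
  e a x -> e a y -> m \in M ->
  connect (induced e (a |: M)) a m -> connect (induced e (b |: M)) m b ->
  connect (induced e (B :\ x)) y b -> connect (induced e (B :\ y)) x b -> False.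
Proof.
move=> aB aM dMB xB yB bB xy xb yb eax eay mM cam cmb cyb cxb.
have key u v v' : u \in B -> e a u -> connect (induced e (B :\ u)) v v' ->
    ~~ (z a v (+) z a v' (+) z u v (+) z u v').
  move=> uB eau; apply: (@even_connect [set a; u]).
    rewrite disjoint_subset; apply/subsetP => s /set2P[]-> ; rewrite !inE ?eqxx //.
    by rewrite (negPf aB) andbF.
  by apply: connect_induced1; rewrite ?inE ?eqxx ?orbT.
(* Say that [u] lies between [a] and [b] when [z a u (+) z u b] is false: exactly one of [u] and [m]
   lies between. *)
have keyM u : u \in B -> u != b -> e a u -> connect (induced e B) u b ->
    z a u (+) z u b (+) z a m (+) z m b.
  move=> uB ub eau cub.
  have mu : u \notin M by rewrite (disjointFl dMB uB).
  have d1 : [disjoint a |: M & B].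
    by rewrite -setI_eq0 setIUl setU_eq0 !setI_eq0 disjoints1 aB.
  have := even_connect d1 cam cub.
  have d2 : [disjoint b |: M & [set a; u]].
    rewrite disjoint_subset; apply/subsetP => s; rewrite !inE => /orP[/eqP->|sM].
      by rewrite negb_or ![b == _]eq_sym ub andbT; apply: contraNneq aB => ->.
    by rewrite negb_or; apply/andP; split; apply: contraTneq sM => ->.
  have cau : connect (induced e [set a; u]) a u.
    by apply: connect_induced1; rewrite ?inE ?eqxx ?orbT.
  have := even_connect d2 cmb cau.
  have ab : a != b by apply: contraNneq aB => ->.
  have am : a != m by apply: contraNneq aM => ->.
  have := zP.1 _ _ ab; have := zP.1 _ _ am; have := zP.1 _ _ ub.
  by do 9!case: (z _ _).
have sB u : B :\ u \subset B := subsetDl _ _.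
(* The first two relations add up to: exactly one of [x] and [y] lies between [a] and [b]. By [keyM]
   both differ from [m] in this respect, but three truth values cannot be pairwise distinct. *)
have := key _ _ _ xB eax cyb; have := key _ _ _ yB eay cxb.
have := keyM _ xB xb eax (connect_inducedS (sB y) cxb).
have := keyM _ yB yb eay (connect_inducedS (sB x) cyb).
have := zP.1 _ _ xy.
by do 9!case: (z _ _).
Qed.

End Tournament.

(** * Boundary states *)

Definition color := (bool * bool)%type.

Definition same_color (c d : color) : bool := (c.1 (+) ~~ d.1) && (c.2 (+) ~~ d.2).

Lemma same_colorE c d : same_color c d = (c == d).
Proof. by move: c d => [[] []] [[] []]. Qed.

(* A state [(c, d, n)] of a boundary vertex [v] of a piece of the graph: [v] has
   colour [c], requires exactly one neighbour of colour [d], and [n] tells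
   whether that neighbour lies inside the piece. *)
Definition vstate := (color * color * bool)%type.

Definition colors : seq color := [seq (x, y) | x <- [:: true; false], y <- [:: true; false]].
Definition vstates : seq vstate :=
  [seq (p, n) | p <- [seq (c, d) | c <- colors, d <- colors], n <- [:: true; false]].

Lemma mem_vstates s : s \in vstates.
Proof. by move: s => [[[[] []] [[] []]] []]. Qed.

(* [leaf] marks the piece reduced to its boundary vertex. *)
Definition rooted_state (leaf : bool) (s : vstate) : bool :=
  let: (c, d, n) := s in if leaf then ~~ n else ~~ (n && same_color c d).

(* The three families of realisable pairs of boundary states were found by
   computing the closure of all two-terminal pieces under series composition and
   keeping the minimal families. *)
Inductive shape := Neutral | Tight | Flexible.

(** [Neutral] asks for no witness inside the piece. [Tight] lists the states of a path with one
    inner vertex: the ends are its only neighbours, hence have distinct colours, and its own colour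
    decides both flags. *)
Definition piece_state (t : shape) (s s' : vstate) : bool :=
  let: (c, d, n) := s in let: (c', d', n') := s' in
  match t with
  | Neutral => ~~ n && ~~ n'
  | Tight => ~~ same_color c c' && ((~~ n && ~~ n') || (n (+) n' (+) same_color d d'))
  | Flexible =>
    [&& ~~ [&& n, n' & same_color c d && same_color c' d' || same_color c d' && same_color c' d]
      & ~~ [&& ~~ n, ~~ n' & pairwise (fun x y => ~~ same_color x y) [:: c; d; c'; d']]]
  end.

(* [r] tells whether the vertices in states [s] and [s'] are adjacent. *)
Definition sees (r : bool) (s s' : vstate) : nat := r && same_color s'.1.1 s.1.2.

Definition with_count (s : vstate) (n : bool) : vstate := (s.1, n).

(** In the default case the composition realises at least the [Neutral] family, and no more is
    claimed. *)
Definition series_shape (t t' : shape) (r : bool) : shape :=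
  match t, t', r with
  | Neutral, Neutral, true => Tight
  | Tight, Tight, true => Flexible
  | _, _, _ => Neutral
  end.

Definition series_ok t t' r (a b x : vstate) (na nb m : bool) : bool :=
  [&& piece_state t (with_count a na) x, piece_state t' (with_count x m) (with_count b nb),
      na + sees true a x == a.2, nb + sees r b x == b.2 &
      x.2 + m + sees true x a + sees r x b == 1].

Lemma series_state t t' r a b : piece_state (series_shape t t' r) a b ->
  exists x na nb m, series_ok t t' r a b x na nb m.
Proof.
(* The three flags are forced by [x] and the required totals, so the search runs over [x] only. *)
pose ok a b x := series_ok t t' r a b x (a.2 && (sees true a x == 0)) (b.2 && (sees r b x == 0))
  (x.2 + sees true x a + sees r x b == 0).
have check : all (fun a => all (fun b => piece_state (series_shape t t' r) a b ==>
    has (ok a b) vstates) vstates) vstates.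
  by rewrite /ok; clear; move: t t' r => [] [] []; vm_cast_no_check (erefl true).
move=> abP; move/allP/(_ a (mem_vstates a))/allP/(_ b (mem_vstates b)): check.
by rewrite abP => /hasP[x _ okx]; do 4!eexists; exact: okx.
Qed.

(** This restores the edge between the ends. The state that [rooted_state] leaves out is impossible
    in a triangle: the root and the neighbour it singles out would share a colour, and the third
    vertex sees just these two. *)
Lemma closing_state t a : rooted_state false a ->
  exists x na, [&& piece_state t (with_count a na) x,
    na + sees true a x == a.2 & x.2 + sees true x a == 1].
Proof.
have check : all (fun a => rooted_state false a ==> has (fun x => has (fun na =>
    [&& piece_state t (with_count a na) x,
    na + sees true a x == a.2 & x.2 + sees true x a == 1]) [:: true; false]) vstates) vstates.
  by case: t; vm_compute.
move=> aP; move/allP/(_ a (mem_vstates a)): check.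
by rewrite aP => /hasP[x _ /hasP[na _ ok]]; exists x, na.
Qed.

Lemma edge_state leaf a : rooted_state false a ->
  exists2 x, rooted_state leaf x & (sees true a x == a.2) && (x.2 + sees true x a == 1).
Proof.
have check : all (fun a => rooted_state false a ==> has (fun x => rooted_state leaf x &&
    ((sees true a x == a.2) && (x.2 + sees true x a == 1))) vstates) vstates.
  by case: leaf; vm_compute.
move=> aP; move/allP/(_ a (mem_vstates a)): check.
by rewrite aP => /hasP[x _ /andP[xP ok]]; exists x.
Qed.

(** * Colouring pieces *)

Section Pieces.
Variables (T : finType) (e : rel T).
Hypotheses (e_sym : symmetric e) (e_irr : irreflexive e).

Implicit Types (S A B K M : {set T}) (F : T -> color * color).

(** [F v] consists of the colour of [v] and the colour of which [v] wants exactly one neighbour. *)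
Definition witnesses F S v : nat := #|[set w in S | e v w && ((F w).1 == (F v).2)]|.

(** Every vertex but [b] is served inside [S]; only [b] may still look for its witness elsewhere. *)
Definition rooted_piece S b :=
  forall s, rooted_state (S == [set b]) s ->
  exists F, [/\ F b = s.1, {in S, forall v, v != b -> witnesses F S v = 1} &
    witnesses F S b = s.2].

(* An edge [ab] is left out of both counts: it is taken into account only when the
   piece is closed ([rooted_closing]) or put in series ([piece_series]). *)
Definition piece S a b :=
  exists t, forall s s', piece_state t s s' ->
  exists F, [/\ F a = s.1, F b = s'.1,
    {in S, forall v, v != a -> v != b -> witnesses F S v = 1},
    witnesses F (S :\ b) a = s.2 & witnesses F (S :\ a) b = s'.2].

Lemma eq_witnesses F F' S v : F v = F' v -> {in S, F =1 F'} -> witnesses F S v = witnesses F' S v.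
Proof.
move=> Fv FS; apply: eq_card => w; rewrite !inE.
by case: (boolP (w \in S)) => //= /FS ->; rewrite Fv.
Qed.

Lemma witnessesU F S S' v : [disjoint S & S'] ->
  witnesses F (S :|: S') v = witnesses F S v + witnesses F S' v.
Proof.
move=> dS; rewrite /witnesses -cardsUI [X in _ = _ + X]eq_card0 ?addn0.
  by apply: eq_card => w; rewrite !inE andb_orl.
move=> w; rewrite !inE; apply/negbTE/negP => /andP[/andP[wS _] /andP[wS' _]].
by rewrite (disjointFr dS wS) in wS'.
Qed.

Lemma witnesses0 F S v : {in S, forall w, ~~ e v w} -> witnesses F S v = 0.
Proof. by move=> nS; apply: eq_card0 => w; rewrite !inE; case: (boolP (w \in S)) => // /nS/negPf->. Qed.

Lemma witnesses_sub F S S' v : S \subset S' -> {in S' :\: S, forall w, ~~ e v w} ->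
  witnesses F S' v = witnesses F S v.
Proof.
move=> sub nS.
have SS' : S :|: S' :\: S = S'.
  by apply/setP => w; rewrite !inE; case: (boolP (w \in S)) => // /(subsetP sub) ->.
rewrite -[in LHS]SS' witnessesU ?(witnesses0 _ nS) ?addn0 //.
by rewrite disjoint_sym disjoints_subset subsetDr.
Qed.

Lemma witnesses1 F v w s s' : F v = s.1 -> F w = s'.1 -> witnesses F [set w] v = sees (e v w) s s'.
Proof.
move=> Fv Fw; rewrite /witnesses /sees same_colorE -Fv -Fw.
case: (boolP (_ && _)) => [ok|nok].
  by rewrite /= -(cards1 w); apply: eq_card => u; rewrite !inE; case: eqVneq => // ->.
by apply: eq_card0 => u; rewrite !inE; case: eqVneq => // ->; rewrite (negPf nok).
Qed.

Lemma glue_colorings F F' S S' : {in S & S', forall u w, u = w -> F u = F' u} ->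
  exists G, {in S, G =1 F} /\ {in S', G =1 F'}.
Proof.
move=> agree; exists (fun v => if v \in S then F v else F' v); split=> v vS; first by rewrite vS.
by case: ifP => // vS1; apply: (agree v v).
Qed.


Lemma witnessesD1 F S w v : w \in S ->
  witnesses F S v = witnesses F [set w] v + witnesses F (S :\ w) v.
Proof. by move=> wS; rewrite -{1}(setD1K wS) witnessesU // disjoints1 !inE eqxx. Qed.

(** The shared vertex [x] is counted on neither side, since it is not its own neighbour. *)
Lemma witnesses_meet F S S' x : S :&: S' = [set x] ->
  witnesses F (S :|: S') x = witnesses F S x + witnesses F S' x.
Proof.
move=> meet; have xS' : x \in S' by have := set11 x; rewrite -meet inE => /andP[].
have -> : S :|: S' = S :|: (S' :\ x).
  apply/setP => w; move/setP/(_ w): meet; rewrite !inE.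
  by case: eqVneq => //= ->; rewrite xS' andbT => ->.
rewrite witnessesU.
  rewrite (@witnesses_sub _ (S' :\ x) S') ?subsetDl // => w; rewrite !inE.
  by case/andP => + wS'; rewrite wS' andbT negbK => /eqP->; rewrite e_irr.
rewrite -setI_eq0; apply/eqP/setP => w; move/setP/(_ w): meet; rewrite !inE.
by case: (w \in S) => //= ->; case: eqVneq.
Qed.

Lemma rooted_edge K x b : b \notin K -> x \in K -> e b x ->
  {in K, forall y, e b y -> y = x} -> rooted_piece K x -> rooted_piece (b |: K) b.
Proof.
move=> bK xK ebx only Kx s.
have bneK y : y \in K -> y != b by move=> yK; apply: contraNneq bK => <-.
have -> : (b |: K == [set b]) = false.
  apply/negbTE/eqP => /setP/(_ x); rewrite !inE xK orbT => /esym/eqP xb.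
  by rewrite -xb xK in bK.
move=> /(edge_state (K == [set x]))[s' /Kx[F [Fx FK nx]]] /andP[/eqP cb /eqP cx].
have [|G [GK Gb]] := @glue_colorings F (fun _ => s.1) K [set b].
  by move=> u w uK /set1P-> ub; rewrite -ub uK in bK.
have Gbs : G b = s.1 by apply: Gb; rewrite set11.
have Gx : G x = s'.1 by rewrite GK.
have wK v : v \in K -> witnesses G K v = witnesses F K v.
  by move=> vK; apply: eq_witnesses => //; apply: GK.
exists G; split=> // [v|].
  case/setU1P => [->|vK _]; first by rewrite eqxx.
  have [->|vx] := eqVneq v x.
    rewrite (witnessesD1 _ _ (setU11 b K)) setU1K // wK // nx.
    by rewrite (witnesses1 Gx Gbs) e_sym ebx addnC.
  rewrite (@witnesses_sub _ K) ?wK ?FK ?subsetU1 // => w; rewrite !inE.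
  case/andP => /negPf-> /orP[/eqP->|//]; rewrite e_sym; apply: contra vx => /only-> //.
rewrite (@witnesses_sub _ [set x]); first by rewrite (witnesses1 Gbs Gx) ebx.
  by rewrite sub1set !inE xK orbT.
move=> w; rewrite !inE => /andP[wx /orP[/eqP->|wK']]; first by rewrite e_irr.
by apply: contra wx => /only->.
Qed.

(** The witness of [b], if any, is supplied by [S]; in [S'] the root gets the flag [false], which is
    always admissible. *)
Lemma rooted_join S S' b : S :&: S' = [set b] -> S != [set b] -> S' != [set b] ->
  {in S & S', forall u w, e u w -> u = b \/ w = b} ->
  rooted_piece S b -> rooted_piece S' b -> rooted_piece (S :|: S') b.
Proof.
move=> meet nS nS' sep pS pS' [[c d] n].
have [bS bS'] : b \in S /\ b \in S'.
  by apply/andP; have := set11 b; rewrite -meet inE.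
have -> : (S :|: S' == [set b]) = false.
  apply/negbTE; apply: contra nS => /eqP/setP US; apply/eqP/setP => w.
  rewrite inE; apply/idP/eqP => [wS|->//].
  by apply/set1P; rewrite -US inE wS.
rewrite /= => st.
have := pS (c, d, n); rewrite (negPf nS) => /(_ st)[F [Fb FS nb]].
have := pS' (c, d, false); rewrite (negPf nS') => /(_ isT)[F' [Fb' FS' nb']].
have [|G [GS GS']] := @glue_colorings F F' S S'.
  move=> u w uS wS' uw; have : u \in S :&: S' by rewrite inE uS uw.
  by rewrite meet => /set1P->; rewrite Fb Fb'.
exists G; split; first by rewrite GS.
  move=> v /setUP[] vin vb.
    rewrite (@witnesses_sub _ S) ?subsetUl //.
      by rewrite (eq_witnesses (F' := F)) ?GS ?FS // => u; apply: GS.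
    move=> w; rewrite !inE => /andP[wS]; rewrite (negPf wS) /= => wS'.
    by apply/negP => /sep[]// E; rewrite E ?eqxx ?bS in vb wS.
  rewrite (@witnesses_sub _ S') ?subsetUr //.
    by rewrite (eq_witnesses (F' := F')) ?GS' ?FS' // => u; apply: GS'.
  move=> w; rewrite !inE => /andP[wS']; rewrite (negPf wS') orbF => wS.
  by rewrite e_sym; apply/negP => /sep[]// E; rewrite E ?eqxx ?bS' in vb wS'.
rewrite witnesses_meet // (eq_witnesses (F' := F)) ?GS // nb.
by rewrite (eq_witnesses (F' := F')) ?GS' // nb' addn0.
Qed.

Lemma rooted_closing S a b : a \in S -> b \in S -> a != b -> e a b ->
  piece S a b -> rooted_piece S a.
Proof.
move=> aS bS ab eab [t pt] s.
have -> : (S == [set a]) = false.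
  apply/negbTE; apply: contra ab => /eqP Sa; rewrite eq_sym.
  by move: bS; rewrite Sa inE.
case/(closing_state t) => s' [n /and3P[/pt[F [Fa Fb FS na nb]] /eqP ca /eqP cb]].
exists F; split=> //.
  move=> v vS va; have [->|vb] := eqVneq v b; last exact: FS.
  by rewrite (witnessesD1 _ _ aS) nb (witnesses1 Fb Fa) e_sym eab addnC.
by rewrite (witnessesD1 _ _ bS) na (witnesses1 Fa Fb) eab addnC.
Qed.

(** The part [A] hanging at [a] is coloured without a witness for [a], so the shape does not
    change. *)
Lemma piece_join A S a b : A :&: S = [set a] -> A != [set a] -> b \in S -> a != b ->
  {in A & S, forall u w, e u w -> u = a \/ w = a} ->
  rooted_piece A a -> piece S a b -> piece (A :|: S) a b.
Proof.
move=> meet nA bS ab sep pA [t pt]; exists t => -[[c d] n] s' /pt[F [Fa Fb FS na nb]].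
have [aA aS] : a \in A /\ a \in S.
  by apply/andP; have := set11 a; rewrite -meet inE.
have bA : b \notin A.
  by apply: contra ab => bA; rewrite eq_sym -in_set1 -meet inE bA.
have := pA (c, d, false); rewrite (negPf nA) => /(_ isT)[F' [Fa' FA' na']].
have [|G [GA GS]] := @glue_colorings F' F A S.
  move=> u w uA wS uw; have : u \in A :&: S by rewrite inE uA uw.
  by rewrite meet => /set1P->; rewrite Fa Fa'.
have eqS S' v : v \in S -> S' \subset S -> witnesses G S' v = witnesses F S' v.
  by move=> vS /subsetP sub; apply: eq_witnesses => [|w /sub]; apply: GS.
have eqA v : v \in A -> witnesses G A v = witnesses F' A v.
  by move=> vA; apply: eq_witnesses => [|w]; apply: GA.
exists G; split; rewrite ?GS ?Fa ?Fb //.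
- move=> v /setUP[] vin va vb.
    rewrite (@witnesses_sub _ A) ?subsetUl ?eqA ?FA' //.
    move=> w; rewrite !inE => /andP[wA]; rewrite (negPf wA) /= => wS.
    by apply/negP => /sep[]// E; rewrite E ?eqxx ?aA in va wA.
  rewrite (@witnesses_sub _ S) ?subsetUr ?eqS ?FS //.
  move=> w; rewrite !inE => /andP[wS]; rewrite (negPf wS) orbF => wA.
  by rewrite e_sym; apply/negP => /sep[]// E; rewrite E ?eqxx ?aS in va wS.
- have -> : (A :|: S) :\ b = A :|: (S :\ b).
    by apply/setP => w; rewrite !inE; case: eqVneq => //= ->; rewrite (negPf bA).
  rewrite witnesses_meet ?eqA ?na' ?eqS ?subsetDl //.
  apply/setP => w; move/setP/(_ w): meet; rewrite !inE => <-.
  by case: eqVneq => //= ->; rewrite (negPf bA).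
- rewrite (@witnesses_sub _ (S :\ a)) ?eqS ?subsetDl //.
    by apply: setSD; apply: subsetUr.
  move=> w; rewrite !inE; case: eqVneq => //= wa.
  case: (boolP (w \in S)) => //= wS; rewrite orbF => wA.
  rewrite e_sym; apply/negP => /sep[]// E; first by rewrite E eqxx in wa.
  by rewrite E eqxx in ab.
Qed.

Lemma piece_isolated B a b : a \notin B -> b \in B ->
  {in B, forall y, e a y -> y = b} -> rooted_piece B b -> piece (a |: B) a b.
Proof.
move=> aB bB only pB; exists Neutral => -[[c d] n] [[c' d'] n'] /= /andP[/negPf-> /negPf->].
have [|F [Fb FB nb]] := pB (c', d', false); first by rewrite /=; case: ifP.
have [|G [GB Ga]] := @glue_colorings F (fun _ => (c, d)) B [set a].
  by move=> u w uB /set1P-> ua; rewrite -ua uB in aB.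
have eqB v : v \in B -> witnesses G B v = witnesses F B v.
  by move=> vB; apply: eq_witnesses => [|w]; apply: GB.
exists G; split.
- by rewrite Ga ?set11.
- by rewrite GB.
- move=> v /setU1P[->|vB] va vb; first by rewrite eqxx in va.
  rewrite (@witnesses_sub _ B) ?subsetU1 ?eqB ?FB //.
  move=> w; rewrite !inE => /andP[/negPf->]; rewrite orbF => /eqP->.
  by rewrite e_sym; apply: contra vb => /only->.
- apply: witnesses0 => w; rewrite !inE => /andP[wb /orP[/eqP->|wB]]; first by rewrite e_irr.
  by apply: contra wb => /only->.
- by rewrite setU1K // eqB.
Qed.

(** The separation hypothesis tolerates an edge [ab], which a piece does not count. Whether [x] and
    [b] are adjacent is passed to [series_shape]. *)
Lemma piece_series S S' a x b : S :&: S' = [set x] -> a \in S -> b \in S' ->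
  a != x -> b != x ->
  {in S & S', forall u w, e u w -> [|| u == x, w == x | (u == a) && (w == b)]} ->
  e a x -> piece S a x -> piece S' x b -> piece (S :|: S') a b.
Proof.
move=> meet aS bS' ax bx sep eax [t pt] [t' pt'].
have [xS xS'] : x \in S /\ x \in S'.
  by apply/andP; have := set11 x; rewrite -meet inE.
have bS : b \notin S by apply: contra bx => bS; rewrite -in_set1 -meet inE bS.
have aS' : a \notin S' by apply: contra ax => aS'; rewrite -in_set1 -meet inE aS.
exists (series_shape t t' (e x b)) => s s'.
case/series_state => sx [n [n' [m /and5P[/pt[F [Fa Fx FS na nx]] /pt'[F' [Fx' Fb FS' nx' nb]]]]]].
move=> /eqP ca /eqP cb /eqP cx.
have [|G [GS GS']] := @glue_colorings F F' S S'.
  move=> u w uS wS' uw; have : u \in S :&: S' by rewrite inE uS uw.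
  by rewrite meet => /set1P->; rewrite Fx Fx'.
have eqS S1 v : v \in S -> S1 \subset S -> witnesses G S1 v = witnesses F S1 v.
  by move=> vS /subsetP sub; apply: eq_witnesses => [|w /sub]; apply: GS.
have eqS' S1 v : v \in S' -> S1 \subset S' -> witnesses G S1 v = witnesses F' S1 v.
  by move=> vS /subsetP sub; apply: eq_witnesses => [|w /sub]; apply: GS'.
have Ga : G a = s.1 by rewrite GS.
have Gb : G b = s'.1 by rewrite GS'.
have Gx : G x = sx.1 by rewrite GS.
exists G; split=> //.
- move=> v vU va vb; have [->|vx] := eqVneq v x.
    rewrite witnesses_meet // (witnessesD1 _ _ aS) (witnessesD1 _ _ bS').
    rewrite (witnesses1 Gx Ga) (witnesses1 Gx Gb) eqS ?eqS' ?subsetDl //.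
    by rewrite nx nx' e_sym eax -cx addnACA addnC [LHS]addnA.
  case/setUP: vU => vin.
    rewrite (@witnesses_sub _ S) ?subsetUl ?eqS ?FS //.
    move=> w; rewrite !inE => /andP[wS]; rewrite (negPf wS) /= => wS'.
    apply/negP => /sep; rewrite (negPf vx) (negPf va) => /(_ vin wS')/=.
    by rewrite orbF => /eqP wx; rewrite wx xS in wS.
  rewrite (@witnesses_sub _ S') ?subsetUr ?eqS' ?FS' //.
  move=> w; rewrite !inE => /andP[wS']; rewrite (negPf wS') orbF => wS.
  rewrite e_sym; apply/negP => /sep; rewrite (negPf vx) (negPf vb) andbF !orbF => /(_ wS vin).
  by move/eqP => wx; rewrite wx xS' in wS'.
- rewrite (@witnesses_sub _ S).
  + by rewrite (witnessesD1 _ _ xS) (witnesses1 Ga Gx) eax eqS ?subsetDl // na addnC.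
  + by apply/subsetP => w wS; rewrite !inE wS andbT; apply: contraNneq bS => <-.
  move=> w; rewrite !inE => /and3P[wS wb]; rewrite (negPf wS) /= => wS'.
  apply/negP => /sep; rewrite (negPf ax) (negPf wb) andbF orbF => /(_ aS wS')/eqP wx.
  by rewrite wx xS in wS.
- rewrite (@witnesses_sub _ S').
  + by rewrite (witnessesD1 _ _ xS') (witnesses1 Gb Gx) e_sym eqS' ?subsetDl // nb addnC.
  + by apply/subsetP => w wS; rewrite !inE wS orbT andbT; apply: contraNneq aS' => <-.
  move=> w; rewrite !inE => /and3P[wS' wa]; rewrite (negPf wS') orbF => wS.
  rewrite e_sym; apply/negP => /sep; rewrite (negPf bx) (negPf wa) /= orbF => /(_ wS bS')/eqP wx.
  by rewrite wx xS' in wS'.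
Qed.

End Pieces.

(** * Decomposition *)

Definition setE := (in_setU1, in_setU, in_setD1, in_setD, in_setI, in_set1).

Section Separators.
Variables (T : finType) (e : rel T).
Hypotheses (e_sym : symmetric e).
Implicit Types (K N : {set T}).

(** Choose [x] with the smallest component of [b] in [K :\ x]. If some [y] in it separated [x] from
    [b], the component of [b] in [K :\ y] would lie inside it and miss [y], against minimality. *)
Lemma exists_nearest K N b : b \in K -> N \subset K :\ b -> N != set0 ->
  exists2 x, x \in N & {in N, forall y, y != x -> y \in comp e (K :\ x) b -> x \in comp e (K :\ y) b}.
Proof.
move=> bK sN /set0Pn[x0 x0N].
case: (arg_minnP (fun x => #|comp e (K :\ x) b|) x0N) => x xN minx; exists x => // y yN yx yC.
have bK' v : v \in N -> b \in K :\ v.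
  by move=> /(subsetP sN); rewrite !setE => /andP[vb _]; rewrite eq_sym vb.
apply: contraT => xC; suff: #|comp e (K :\ y) b| < #|comp e (K :\ x) b| by rewrite ltnNge minx.
apply: proper_card.
have sub : comp e (K :\ y) b \subset comp e (K :\ x) b.
  apply: comp_max (conn_comp e_sym (bK' _ yN)) (comp_refl _ _ _) _.
  rewrite subsetD1 xC andbT; exact: subset_trans (comp_sub e (bK' _ yN)) (subsetDl _ _).
apply/properP; split=> //; exists y => //.
by apply/negP => /(subsetP (comp_sub e (bK' _ yN))); rewrite !setE eqxx.
Qed.

(** Choose [x] with the largest component of [b]. For a [y] outside it, [x] and this whole component
    would stay together in [K :\ y], against maximality. *)
Lemma exists_farthest K N b : conn e K -> b \in N -> N \subset K -> N != [set b] ->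
  exists2 x, x \in N :\ b & {in N, forall y, y != x -> y \in comp e (K :\ x) b}.
Proof.
move=> cK bN sN Nb.
have [x0 x0N] : exists x0, x0 \in N :\ b.
  apply/set0Pn; apply: contra Nb => /eqP/setP N0; apply/eqP/setP => v.
  by have := N0 v; rewrite !inE; case: eqVneq => // ->.
case: (arg_maxnP (fun x => #|comp e (K :\ x) b|) x0N) => x xN maxx; exists x => // y yN yx.
have [xb xK] : x != b /\ x \in K.
  by move/setD1P: xN => [-> /(subsetP sN)].
have bK : b \in K by apply: (subsetP sN).
have bKx : b \in K :\ x by rewrite !setE eq_sym xb.
apply: contraT => yC.
have yb : y != b by apply: contraNneq yC => ->; apply: comp_refl.
have bx : b != x by rewrite eq_sym.
have [u uC exu] := comp_adj e_sym cK xK bK bx.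
have yNb : y \in N :\ b by rewrite !setE yb.
suff: #|comp e (K :\ x) b| < #|comp e (K :\ y) b| by rewrite ltnNge (maxx y yNb : _ <= _).
apply: proper_card.
have sub : x |: comp e (K :\ x) b \subset comp e (K :\ y) b.
  apply: comp_max (connU1 e_sym (conn_comp e_sym bKx) uC exu) _ _.
    by rewrite setU1r ?comp_refl.
  rewrite subUset sub1set !setE eq_sym yx xK subsetD1 yC /= andbT.
  exact: subset_trans (comp_sub e bKx) (subsetDl _ _).
apply/properP; split; first exact: subset_trans (subsetUr _ _) sub.
exists x; first by apply: (subsetP sub); rewrite setU11.
by apply/negP => /(subsetP (comp_sub e bKx)); rewrite !setE eqxx.
Qed.

End Separators.

Section Decomposition.
Variables (T : finType) (e : rel T) (z : rel T).
Hypotheses (e_sym : symmetric e) (e_irr : irreflexive e).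
Hypothesis zP : even_tournament e z.
Implicit Types (S B K M : {set T}).

(* Contracting [M] turns the handle into a path of length two from [a] to [b]
   outside [S], which keeps [a] and [b] on the outer boundary of [S]. *)
Definition handle S a b := exists M,
  [/\ conn e M, [disjoint M & S], exists2 u, u \in M & e a u & exists2 u, u \in M & e b u].

(** Edges between [C] and the rest of [a |: B] pass through [x], except for a possible edge [ab];
    hence a series composition at [x]. *)
Lemma piece_split B a b x (C := comp e (B :\ x) b) :
  (forall S c d, #|S| < #|a |: B| -> conn e S -> c \in S -> d \in S -> c != d ->
     handle S c d -> piece e S c d) ->
  conn e B -> a \notin B -> b \in B -> x \in B -> b != x -> e a x ->
  {in C, forall y, e a y -> y = b} ->
  handle (a |: (B :\: C)) a x -> handle (x |: C) x b -> piece e (a |: B) a b.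
Proof.
move=> IH cB aB bB xB bx eax sep hS hS'.
have bBx : b \in B :\ x by rewrite !setE bx.
have sC : C \subset B :\ x := comp_sub e bBx.
have sCB : C \subset B := subset_trans sC (subsetDl _ _).
have bC : b \in C := comp_refl _ _ _.
have xC : x \notin C by apply/negP => /(subsetP sC); rewrite !setE eqxx.
have [u uC exu] := comp_adj e_sym cB xB bB bx.
have ax : a != x by apply: contraNneq aB => ->.
have ab : a != b by apply: contraNneq aB => ->.
have aC : a \notin C by apply: contra aB; apply: (subsetP sCB).
have -> : a |: B = (a |: (B :\: C)) :|: (x |: C).
  apply/setP => w; rewrite !setE; case: (boolP (w \in C)) => [/(subsetP sCB)->|_]; rewrite ?orbT //=.
  by rewrite orbF; have [->|] := eqVneq w x; rewrite ?xB ?orbT ?orbF ?andbT.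
apply: (@piece_series _ _ e_sym e_irr _ _ _ x) => //.
- apply/setP => w; rewrite !setE; have [->|wx] /= := eqVneq w x; first by rewrite xC xB orbT.
  by case: (boolP (w \in C)); rewrite ?andbF //= orbF andbT => wC; apply: contraNF aC => /eqP<-.
- by rewrite setU11.
- by rewrite setU1r.
- move=> v w /setU1P vin /setU1P win evw.
  case: vin => [va|/setDP[vB vC]].
    case: win => [->|/[dup] wC /sep wb]; first by rewrite eqxx orbT.
    by rewrite -va in wb; rewrite va wb ?eqxx ?orbT.
  case: win => [->|wC]; first by rewrite eqxx orbT.
  have [->//|vx] /= := eqVneq v x.
  by case/negP: vC; apply: comp_step bBx wC _ _; rewrite ?setE ?vx // e_sym.
- apply: IH => //.
  + apply/proper_card/properP; split; first by apply: setUS; apply: subsetDl.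
    by exists b; rewrite !setE ?bB ?orbT // bC orbF eq_sym.
  + by apply: connU1 eax; rewrite ?setE ?xC //; apply: conn_setD_comp.
  + by rewrite setU11.
  + by rewrite !setE xC xB orbT.
- apply: IH => //.
  + apply/proper_card/properP; split.
      by rewrite subUset sub1set !setE xB orbT subsetU // sCB orbT.
    by exists a; rewrite !setE ?eqxx // negb_or ax.
  + by apply: connU1 uC exu => //; apply: conn_comp.
  + by rewrite setU11.
  + by rewrite setU1r.
  + by rewrite eq_sym.
Qed.

(** The two statements are proved together because each step uses smaller instances of both. *)
Lemma pieces n :
  (forall S b, #|S| <= n -> conn e S -> b \in S -> rooted_piece e S b) /\
  (forall S a b, #|S| <= n -> conn e S -> a \in S -> b \in S -> a != b ->
    handle S a b -> piece e S a b).
Proof.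
elim: n => [|n [IHr IHp]].
  by split=> [S b|S a b]; rewrite leqn0 cards_eq0 => /eqP-> _; rewrite in_set0.
split=> [S b sizeS cS bS|S a b sizeS cS aS bS ab [M [cM dM [ma maM eam] [mb mbM ebm]]]].
  have [->|Sb] := eqVneq S [set b].
    move=> [[c d] k]; rewrite /rooted_state eqxx => /negPf->; exists (fun _ => (c, d)); split=> //.
      by move=> v /set1P-> /eqP.
    by apply: witnesses0 => w /set1P->; rewrite e_irr.
  have [y yS] : exists y, y \in S :\ b.
    apply/set0Pn; apply: contra Sb => /eqP/setP S0; apply/eqP/setP => v.
    by have := S0 v; rewrite !inE; case: eqVneq => // ->.
  have [yb ySS] : y != b /\ y \in S by move: yS; rewrite !setE => /andP.
  set K := comp e (S :\ b) y.
  have yK : y \in K := comp_refl _ _ _.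
  have sK : K \subset S :\ b := comp_sub e yS.
  have sKS : K \subset S := subset_trans sK (subsetDl _ _).
  have bK : b \notin K by apply/negP => /(subsetP sK); rewrite !setE eqxx.
  have cK : conn e K := conn_comp e_sym yS.
  have [u uK ebu] := comp_adj e_sym cS bS ySS yb.
  have [KS|KS] := eqVneq K (S :\ b); last first.
    have [w wS wK] : exists2 w, w \in S :\ b & w \notin K.
      by apply/subsetPn; apply: contra KS; rewrite eqEsubset sK.
    have [wb wSS] : w != b /\ w \in S by move: wS; rewrite !setE => /andP.
    have -> : S = (S :\: K) :|: (b |: K).
      apply/setP => v; rewrite !setE; case: (boolP (v \in K)) => [/(subsetP sKS)->|_]; rewrite ?orbT //=.
      by rewrite orbF; case: eqVneq => [->|]; rewrite ?bS ?orbF.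
    apply: rooted_join => //.
    - apply/setP => v; rewrite !setE; have [->|] /= := eqVneq v b; first by rewrite bK bS.
      by case: (v \in K) => //; rewrite andbF.
    - by apply: contra wb => /eqP/setP/(_ w); rewrite !setE wK wSS => /esym.
    - by apply: contra yb => /eqP/setP/(_ y); rewrite !setE yK orbT => /esym.
    - move=> v v' /setDP[vS vK] /setU1P[->|v'K] evv'; [by right | left].
      apply/eqP; apply: contraNT vK => vb.
      by apply: comp_step yS v'K _ _; rewrite ?setE ?vb // e_sym.
    - apply: IHr; last by rewrite !setE bK.
        rewrite -ltnS; apply: leq_trans sizeS; apply/proper_card/properP; split; first exact: subsetDl.
        by exists y => //; rewrite !setE yK.
      exact: conn_setD_comp.
    - apply: IHr; last by rewrite setU11.
        rewrite -ltnS; apply: leq_trans sizeS; apply/proper_card/properP; split.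
          by rewrite subUset sub1set bS.
        by exists w => //; rewrite !setE negb_or wb.
      exact: connU1 uK ebu.
  have SE : S = b |: K by rewrite KS setD1K.
  have IHK x : x \in K -> rooted_piece e K x.
    apply: IHr => //; rewrite -ltnS; apply: leq_trans sizeS; apply/proper_card/properP.
    by split=> //; exists b.
  pose N := [set v in K | e b v].
  have uN : u \in N by rewrite in_set uK.
  have sN : N \subset K by apply/subsetP => v; rewrite inE => /andP[].
  rewrite SE; have [Nu|Nu] := eqVneq N [set u].
    apply: (rooted_edge e_sym e_irr bK uK ebu _ (IHK _ uK)) => v vK ebv.
    by apply/set1P; rewrite -Nu in_set vK.
  (* Deleting [x] leaves the other neighbours of [b] joined in [K]. The edge [bx] is set aside for
     [rooted_closing], and the piece with ends [b] and [x] is cut at the neighbour [x'] of [b]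
     nearest to [x]. *)
  have [x xN far] := exists_farthest e_sym cK uN sN Nu.
  have [xu xK ebx] : [/\ x != u, x \in K & e b x].
    by move: xN; rewrite !inE => /and3P.
  have [||x' x'N near] := @exists_nearest _ _ e_sym K (N :\ x) x xK; first exact: setSD.
    by apply/set0Pn; exists u; rewrite in_setD1 uN eq_sym xu.
  have [x'x x'K ebx'] : [/\ x' != x, x' \in K & e b x'].
    by move: x'N; rewrite !inE => /and3P.
  have bx : b != x by apply: contraNneq bK => ->.
  have xKx' : x \in K :\ x' by rewrite !setE eq_sym x'x.
  have xx' : x != x' by rewrite eq_sym.
  have [u' u'C exu'] := comp_adj e_sym cK x'K xK xx'.
  apply: (@rooted_closing _ _ e_sym _ b x); rewrite ?setU11 ?setU1r //.
  apply: (@piece_split _ _ _ x') => //.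
  - move=> S' c d; rewrite -SE => S'S; apply: IHp; rewrite -ltnS; exact: leq_trans sizeS.
  (* A further neighbour [y'] would give three neighbours of [b], any two of them joined in [K] off
     the third: the K4 obstruction. *)
  - move=> y' y'C eby'; apply/eqP; apply/negPn/negP => y'x.
    have := subsetP (comp_sub e xKx') _ y'C; rewrite !setE => /andP[y'x' y'K].
    have y'N : y' \in N :\ x by rewrite in_setD1 in_set y'x y'K.
    have x'C := near y' y'N y'x' y'C.
    have farx v : v \in N :\ x -> connect (induced e (K :\ x)) u v.
      by rewrite in_setD1 => /andP[vx vN]; have := far v vN vx; rewrite inE.
    apply: (no_triangle_of_neighbours zP bK y'K x'K xK y'x' y'x x'x eby' ebx' ebx).
    + by apply: connect_trans (farx _ x'N); rewrite induced_connect_sym ?farx.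
    + by move: y'C; rewrite inE induced_connect_sym.
    + by move: x'C; rewrite inE induced_connect_sym.
  (* Each of the two pieces has its handle in the other: the part around [x] for the first, [b]
     alone for the second. *)
  - exists (comp e (K :\ x') x); split.
    + exact: conn_comp.
    + rewrite disjoint_subset; apply/subsetP => v vC.
      rewrite inE !setE negb_or vC /= andbT; apply: contraNneq bK => <-.
      by have := subsetP (comp_sub e xKx') _ vC; rewrite in_setD1 => /andP[].
    + by exists x; rewrite ?comp_refl.
    + by exists u'.
  - exists [set b]; split; first exact: conn1.
    + rewrite disjoints1 in_setU1 negb_or; apply/andP; split; first by apply: contraNneq bK => ->.
      by apply: contra bK => /(subsetP (comp_sub e xKx')); rewrite inE => /andP[].
    + by exists b; rewrite ?set11 // e_sym.
    + by exists b; rewrite ?set11 // e_sym.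
(* Two ends: whatever lies outside [a |: B] hangs at [a] and is split off first. *)
set B := comp e (S :\ a) b.
have bSa : b \in S :\ a by rewrite !setE eq_sym ab.
have bB : b \in B := comp_refl _ _ _.
have sB : B \subset S :\ a := comp_sub e bSa.
have sBS : B \subset S := subset_trans sB (subsetDl _ _).
have aB : a \notin B by apply/negP => /(subsetP sB); rewrite !setE eqxx.
have cB : conn e B := conn_comp e_sym bSa.
have ba : b != a by rewrite eq_sym.
have [u uB eau] := comp_adj e_sym cS aS bS ba.
have aM : a \notin M by rewrite (disjointFl dM aS).
have dMB : [disjoint M & B] by apply: disjointWr dM.
have [BS|BS] := eqVneq B (S :\ a); last first.
  have [w wS wB] : exists2 w, w \in S :\ a & w \notin B.
    by apply/subsetPn; apply: contra BS; rewrite eqEsubset sB.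
  have [wa wSS] : w != a /\ w \in S by move: wS; rewrite !setE => /andP.
  have -> : S = (S :\: B) :|: (a |: B).
    apply/setP => v; rewrite !setE; case: (boolP (v \in B)) => [/(subsetP sBS)->|_]; rewrite ?orbT //=.
    by rewrite orbF; case: eqVneq => [->|]; rewrite ?aS ?orbF.
  apply: piece_join => //.
  - apply/setP => v; rewrite !setE; have [->|] /= := eqVneq v a; first by rewrite aB aS.
    by case: (v \in B) => //; rewrite andbF.
  - by apply: contra wa => /eqP/setP/(_ w); rewrite !setE wB wSS => /esym.
  - by rewrite setU1r.
  - move=> v v' /setDP[vS vB] /setU1P[->|v'B] evv'; [by right | left].
    apply/eqP; apply: contraNT vB => va.
    by apply: comp_step bSa v'B _ _; rewrite ?setE ?va // e_sym.
  - apply: IHr; last by rewrite !setE aB.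
      rewrite -ltnS; apply: leq_trans sizeS; apply/proper_card/properP; split; first exact: subsetDl.
      by exists b => //; rewrite !setE bB.
    exact: conn_setD_comp ba.
  - apply: IHp; rewrite ?setU11 ?setU1r //.
    + rewrite -ltnS; apply: leq_trans sizeS; apply/proper_card/properP; split.
        by rewrite subUset sub1set aS.
      by exists w => //; rewrite !setE negb_or wa.
    + exact: connU1 uB eau.
    + exists M; split=> //; [|by exists ma|by exists mb].
      by apply: disjointWr dM; rewrite subUset sub1set aS.
have SE : S = a |: B by rewrite BS setD1K.
pose N := [set v in B :\ b | e a v].
have sN : N \subset B :\ b by apply/subsetP => v; rewrite inE => /andP[].
rewrite SE; have [N0|N0] := eqVneq N set0.
  apply: piece_isolated => // [v vB eav|].
    apply/eqP; apply: contraT => vb; have := in_set0 v.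
    by rewrite -N0 inE eav andbT in_setD1 vb vB.
  apply: IHr => //; rewrite -ltnS; apply: leq_trans sizeS; apply/proper_card/properP.
  by split=> //; exists a.
have [x xN near] := exists_nearest e_sym bB sN N0.
have [xb xB eax] : [/\ x != b, x \in B & e a x] by move: xN; rewrite !inE => /andP[/andP[]].
have bx : b != x by rewrite eq_sym.
have bBx : b \in B :\ x by rewrite !setE bx.
have sC := comp_sub e bBx.
have [w wC exw] := comp_adj e_sym cB xB bB bx.
apply: (@piece_split _ _ _ x) => //.
- move=> S' c d; rewrite -SE => S'S; apply: IHp; rewrite -ltnS; exact: leq_trans sizeS.
(* Another neighbour [y] of [a] on the side of [b] would give connections from [a] to [b] through
   [x], [y] and [M], against [no_theta]. *)
- move=> y yC eay; apply/eqP; apply/negPn/negP => yb.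
  have := subsetP sC _ yC; rewrite !setE => /andP[yx yB].
  have yN : y \in N by rewrite in_set in_setD1 yb yB.
  have xC := near y yN yx yC.
  apply: (@no_theta _ _ _ zP B M a b x y ma) => //.
  + by rewrite eq_sym.
  + by apply: connect_induced1; rewrite ?setU11 ?setU1r.
  + apply: (@connect_trans _ _ mb).
      by apply: connect_inducedS (cM _ _ maM mbM); apply: subsetUr.
    by apply: connect_induced1; rewrite ?setU11 ?setU1r // e_sym.
  + by move: yC; rewrite inE induced_connect_sym.
  + by move: xC; rewrite inE induced_connect_sym.
- exists (M :|: comp e (B :\ x) b); split.
  + by apply: (connU e_sym cM (conn_comp e_sym bBx) mbM (comp_refl _ _ _)); rewrite e_sym.
  + rewrite disjoint_subset; apply/subsetP => v; rewrite in_setU => /orP[vM|vC]; rewrite inE.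
      have vS : v \notin S by rewrite (disjointFr dM vM).
      by move: vS; rewrite SE !setE !negb_or => /andP[-> vB]; rewrite (negPf vB) andbF.
    rewrite !setE negb_or vC /= andbT; apply: contraNneq aB => <-.
    by have := subsetP sC _ vC; rewrite inE => /andP[].
  + by exists ma => //; rewrite in_setU maM.
  + by exists w => //; rewrite in_setU wC orbT.
- exists (a |: M); split.
  + exact: connU1 maM eam.
  + rewrite disjoint_subset; apply/subsetP => v; rewrite in_setU1 => vin; rewrite inE.
    apply/negP => /setU1P vin'; have vB : v \in B.
      by case: vin' => [->//|/(subsetP sC)]; rewrite inE => /andP[].
    case/orP: vin => [/eqP va|vM]; first by rewrite -va vB in aB.
    by rewrite (disjointFr dMB vM) in vB.
  + by exists a; rewrite ?setU11 // e_sym.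
  + by exists mb; rewrite ?setU1r.
Qed.

Lemma tournament_witnesses : (forall u v, connect e u v) -> (forall v, exists u, e v u) ->
  exists F : T -> color * color, forall v, witnesses e F setT v = 1.
Proof.
move=> con niso; case: (pickP (@predT T)) => [b _|T0]; last first.
  by exists (fun _ => (true, true, (true, true))) => v; have := T0 v.
have cT : conn e setT.
  move=> u v _ _; have := con u v; rewrite (@eq_connect _ _ (induced e setT)) // => x y.
  by rewrite /induced /= !in_setT.
have bT : b \in [set: T] by rewrite inE.
(* The root has and requires different colours, so its state with flag [true] is admissible. *)
have [|F [_ FS Fb]] := (pieces #|T|).1 setT b (eq_leq (cardsT T)) cT bT (true, true, (true, false), true).
  rewrite /rooted_state; case: eqP => // /setP Tb; have [u ebu] := niso b.
  by have := Tb u; rewrite in_setT in_set1; case: eqVneq => // ub; rewrite ub e_irr in ebu.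
by exists F => v; have [->|] := eqVneq v b; [rewrite Fb | apply: FS; rewrite in_setT].
Qed.

End Decomposition.

From mathcomp Require Import all_order all_algebra.
From mathcomp Require Import all_classical all_reals all_analysis.
From mathcomp Require Import lra.
Import Order.TTheory GRing.Theory Num.Theory.
Import numFieldNormedType.Exports.

(** * Parity of half-turns *)

Section HalfTurns.
Local Open Scope ring_scope.
Variable R : realDomainType.
Implicit Types (p q u v w : (R * R)%type) (s t : seq (R * R)%type) (r : R).

Definition nearby r u v := (`|u.1 - v.1| < r) && (`|u.2 - v.2| < r).
Definition apart r u v := (r <= `|u.1 - v.1|) || (r <= `|u.2 - v.2|).

(** A half-plane with half of its boundary line: it contains exactly one of [u] and [- u] for
    nonzero [u]. *)
Definition upward u := (0 < u.2) || ((u.2 == 0) && (0 < u.1)).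
(* Whether the short step from [u] to [v] crosses the positive half of the
   horizontal axis. *)
Definition flip u v := (upward u (+) upward v) && (0 < u.1).

Lemma upwardN u : u != 0 -> upward (- u) = ~~ upward u.
Proof.
case: u => x y; rewrite /upward /= xpair_eqE => nz.
rewrite !oppr_gt0 oppr_eq0; case: (ltrgtP y 0) nz => //= _.
by rewrite andbT; case: (ltrgtP x 0).
Qed.

(** A change of [upward] within distance [r] forces [u.2] below [r] in absolute value, hence [u.1]
    is at least [r], and its sign is shared by every nearby [w]. *)
Lemma flipE r u v w : apart r u 0 -> nearby r u v -> nearby r u w ->
  flip u v = (upward u (+) upward v) && (0 < w.1).
Proof.
case: u v w => [x y] [x' y'] [x'' y'']; rewrite /apart /nearby /flip /upward /= !subr0.
move=> far /andP[cx cy] /andP[cx' _]; case: (boolP (_ (+) _)) => //= turn.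
suff x_far : r <= `|x|.
  move: x_far cx'; rewrite ler_normr ltr_norml => /orP[] ? /andP[? ?].
    by apply/idP/idP => _; lra.
  by apply/idP/idP => ?; lra.
case/orP: far => // far; exfalso; move: turn far cy; rewrite ler_normr ltr_norml.
by case: (ltrgtP y 0) => ?; case: (ltrgtP y' 0) => ? //= _ /orP[] ? /andP[? ?]; lra.
Qed.

Lemma apart_neq0 r u : 0 < r -> apart r u 0 -> u != 0.
Proof.
move=> r0; apply: contraTneq => ->.
by rewrite /apart subr0 normr0 leNgt r0.
Qed.

(** The opposite step crosses the other half of the axis; both halves together account for the
    change of [upward]. *)
Lemma flipN r u v : 0 < r -> apart r u 0 -> apart r v 0 -> nearby r u v ->
  flip (- u) (- v) = flip u v (+) upward u (+) upward v.
Proof.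
move=> r0 far farv cl.
rewrite /flip !upwardN ?(apart_neq0 r0) // addNb addbN negbK.
case: (boolP (_ (+) _)) => [turn|/negPf E] /=; last by move: E; do 2!case: (upward _).
rewrite -addbA turn addbT oppr_gt0.
suff : u.1 != 0 by case: ltrgtP.
apply: contraTneq turn => u0.
case: u v u0 far cl {farv} => [x y] [x' y'] /= ->.
rewrite /apart /nearby /upward /= !subr0 normr0 leNgt r0 /=.
rewrite ler_normr ltr_norml => /orP[] far /andP[_]; rewrite ltr_norml => /andP[? ?].
all: by case: (ltrgtP y 0) => ?; case: (ltrgtP y' 0) => ? //=; lra.
Qed.

Fixpoint turn u s : bool := if s is v :: s' then flip u v (+) turn v s' else false.
(** For short steps away from [q] and a closed chain, this is the winding number around [q] modulo
    2. *)
Definition wind q p s : bool := turn (p - q) [seq x - q | x <- s].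

Lemma nearbyC r u v : nearby r u v = nearby r v u.
Proof. by rewrite /nearby [`|u.1 - _|]distrC [`|u.2 - _|]distrC. Qed.

Lemma apartC r u v : apart r u v = apart r v u.
Proof. by rewrite /apart [`|u.1 - _|]distrC [`|u.2 - _|]distrC. Qed.

Lemma apart_sub r u v : apart r (u - v) 0 = apart r u v.
Proof. by rewrite /apart !subr0. Qed.

(** The four differences stay near [w] and away from 0, so by [flipE] all steps test the half-axis
    at [w] and the changes of [upward] cancel. The bound is [r + r] because both points move. *)
Lemma flip_square r u v u' v' : nearby r u v -> nearby r u' v' ->
  apart (r + r) u u' -> apart (r + r) u v' -> apart (r + r) v u' -> apart (r + r) v v' ->
  flip (u' - u) (v' - u) (+) flip (u' - v) (v' - v) =
  flip (u' - u) (u' - v) (+) flip (v' - u) (v' - v).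
Proof.
move=> cl cl' auu auv avu avv; pose w := u' - u.
have near a a' b b' : nearby r a a' -> nearby r b b' -> nearby (r + r) (b - a) (b' - a').
  rewrite /nearby !ltr_norml => /andP[/andP[? ?] /andP[? ?]] /andP[/andP[? ?] /andP[? ?]].
  by apply/andP; split; apply/andP; split => /=; lra.
have r0 : 0 < r by apply: le_lt_trans (normr_ge0 _) (proj1 (andP cl)).
have nearbyxx x : nearby r x x by rewrite /nearby !subrr normr0 r0.
by rewrite !(@flipE (r + r) _ _ w) ?apart_sub ?(apartC _ u') ?(apartC _ v') ?near // 1?nearbyC //;
  do 4!case: (upward _); case: (0 < _).
Qed.

Lemma wind_step r u v p s : nearby r u v -> path (nearby r) p s ->
  {in p :: s, forall q, apart (r + r) u q && apart (r + r) v q} ->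
  wind u p s (+) wind v p s =
  flip (p - u) (p - v) (+) flip (last p s - u) (last p s - v).
Proof.
move=> cl; elim: s p => [|q s IH] p /=; first by rewrite addbb.
case/andP=> clp ps far; rewrite /wind /= -!/(wind _ _ _).
have /andP[up vp] := far p (mem_head _ _).
have /andP[uq vq] : apart (r + r) u q && apart (r + r) v q.
  by apply: far; rewrite !inE eqxx orbT.
have := flip_square cl clp up uq vp vq.
have far' : {in q :: s, forall x, apart (r + r) u x && apart (r + r) v x}.
  by move=> x xs; apply: far; rewrite inE xs orbT.
have := IH q ps far'.
by do 2!case: (wind _ _ _); do 5!case: (flip _ _).
Qed.

(** Summing the squares over all pairs of steps leaves only the boundary of the grid of
    differences. *)
Lemma wind_grid r p s q t : path (nearby r) p s -> path (nearby r) q t ->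
  {in p :: s & q :: t, forall u v, apart (r + r) u v} ->
  wind p q t (+) wind (last p s) q t =
  turn (q - p) [seq q - x | x <- s] (+) turn (last q t - p) [seq last q t - x | x <- s].
Proof.
move=> ps qt; elim: s p ps => [|x s IH] p /=; first by rewrite addbb.
case/andP=> px xs far.
have far' : {in x :: s & q :: t, forall u v, apart (r + r) u v}.
  by move=> u v us; apply: far; rewrite inE us orbT.
have := IH x xs far'.
have step : {in q :: t, forall v, apart (r + r) p v && apart (r + r) x v}.
  by move=> v vt; rewrite !far // !inE eqxx ?orbT.
have := wind_step px qt step.
by do 3!case: (wind _ _ _); do 2!case: (turn _ _); do 2!case: (flip _ _).
Qed.

Lemma turn_opposite r q p s : 0 < r -> path (nearby r) p s ->
  {in p :: s, forall x, apart r x q} ->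
  turn (q - p) [seq q - x | x <- s] = wind q p s (+) upward (q - p) (+) upward (q - last p s).
Proof.
move=> r0; elim: s p => [|x s IH] p /=; first by rewrite addbb.
case/andP=> px xs far; rewrite /wind /= -!/(wind _ _ _).
have far' : {in x :: s, forall y, apart r y q} by move=> y ys; apply: far; rewrite inE ys orbT.
rewrite IH // -[q - p]opprB -[q - x]opprB.
have cl : nearby r (p - q) (x - q) by move: px; rewrite /nearby /= !opprB !addrA !subrK.
rewrite (@flipN r) // ?apart_sub ?far ?inE ?eqxx ?orbT //.
rewrite !upwardN ?(@apart_neq0 r) ?apart_sub ?far ?inE ?eqxx ?orbT //.
by case: (flip _ _); case: (wind _ _ _); do 3!case: (upward _).
Qed.

Lemma wind_pair r p s q t : 0 < r -> path (nearby r) p s -> path (nearby r) q t ->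
  {in p :: s & q :: t, forall u v, apart (r + r) u v} ->
  wind p q t (+) wind (last p s) q t (+) wind q p s (+) wind (last q t) p s =
  upward (q - p) (+) upward (q - last p s) (+)
  upward (last q t - p) (+) upward (last q t - last p s).
Proof.
move=> r0 ps qt far; rewrite (wind_grid ps qt far).
have le2 u v : apart (r + r) u v -> apart r u v.
  by rewrite /apart => /orP[] h; apply/orP; [left|right]; lra.
rewrite !(turn_opposite r0 ps) => [|x xs|x xs]; last 2 first.
- by apply: le2; apply: far => //; rewrite ?mem_head ?mem_last.
- by apply: le2; apply: far => //; rewrite ?mem_head ?mem_last.
by do 2!case: (wind _ _ _); do 4!case: (upward _).
Qed.

End HalfTurns.

(** * The tournament defined by rays *)

Lemma addb_eliminate k t a b n u v a' b' n' u' v' :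
  a (+) b (+) k (+) n = t (+) (u (+) v) -> a' (+) b' (+) k (+) n' = t (+) (u' (+) v') ->
  n (+) n' = (a (+) a') (+) (b (+) b') (+) (u (+) u') (+) (v (+) v').
Proof.
move/(canRL (addKb _)) => -> /(canRL (addKb _)) ->; rewrite -[RHS]addbA (addbACA a) (addbACA u).
by case: k; case: t; case: (a (+) b); case: (a' (+) b'); case: (u (+) v); case: (u' (+) v').
Qed.

Lemma addb_regroup a a' b b' c c' d d' u u' v v' :
  (a (+) c (+) u) (+) (a' (+) d (+) u') (+) (b (+) c' (+) v) (+) (b' (+) d' (+) v') =
  ((a (+) a') (+) (b (+) b')) (+) ((c (+) c') (+) (d (+) d')) (+) ((u (+) u') (+) (v (+) v')).
Proof.
rewrite -addbA (addbACA (a (+) c)) (addbACA (b (+) c')) (addbACA _ (u (+) u')).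
by rewrite (addbACA a) (addbACA b) (addbACA (a (+) a')) (addbACA c).
Qed.

Section ChainDrawing.
Local Open Scope ring_scope.
Variables (R : realDomainType) (T : finType) (e : rel T).
Variables (pos : T -> R * R) (arc : T -> T -> seq (R * R)) (q : R * R) (ray : T -> seq (R * R)) (r : R).
Hypothesis r_gt0 : 0 < r.
Hypothesis pos_inj : injective pos.
Hypothesis arc_path : forall a b, e a b -> path (nearby r) (pos a) (arc a b).
Hypothesis arc_last : forall a b, e a b -> last (pos a) (arc a b) = pos b.
Hypothesis ray_path : forall a, path (nearby r) q (ray a).
Hypothesis ray_last : forall a, last q (ray a) = pos a.
Hypothesis arc_arc : forall a b c d, e a b -> e c d -> a != c -> a != d -> b != c -> b != d ->
  {in pos a :: arc a b & pos c :: arc c d, forall x y, apart (r + r) x y}.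
Hypothesis arc_ray : forall a b c, e a b -> a != c -> b != c ->
  {in pos a :: arc a b & q :: ray c, forall x y, apart (r + r) x y}.

(** The winding terms together are symmetric in [a] and [c]; the last term is what makes this a
    tournament. *)
Definition ray_order a c : bool :=
  wind (pos a) q (ray c) (+) wind (pos c) q (ray a) (+) upward (pos a - pos c).

(* [wind_pair] for an arc and a ray expresses the winding of the arc around a
   vertex through the rays; substituting this in [wind_pair] for two arcs
   eliminates the arcs. *)
Lemma ray_order_even : even_tournament e ray_order.
Proof.
have upC a c : a != c -> upward (pos a - pos c) = ~~ upward (pos c - pos a).
  by move=> ac; rewrite -opprB upwardN // subr_eq0 (inj_eq pos_inj) eq_sym.
have mixed a b c d : e a b -> a != c -> a != d -> b != c -> b != d ->
  wind (pos c) (pos a) (arc a b) (+) wind (pos d) (pos a) (arc a b) =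
  (wind (pos a) q (ray c) (+) wind (pos a) q (ray d)) (+)
  (wind (pos b) q (ray c) (+) wind (pos b) q (ray d)) (+)
  (upward (pos c - pos a) (+) upward (pos d - pos a)) (+)
  (upward (pos c - pos b) (+) upward (pos d - pos b)).
  move=> eab ac ad bc bd.
  (* The winding of the arc around [q] does not depend on [x], so adding the instances for [c] and
     [d] eliminates it. *)
  have eqn x : a != x -> b != x -> 
    wind (pos a) q (ray x) (+) wind (pos b) q (ray x) (+) wind q (pos a) (arc a b) (+)
    wind (pos x) (pos a) (arc a b) = (upward (q - pos a) (+) upward (q - pos b)) (+)
    (upward (pos x - pos a) (+) upward (pos x - pos b)).
    move=> ax bx.
    have := wind_pair r_gt0 (arc_path eab) (ray_path x) (arc_ray eab ax bx).
    by rewrite arc_last // ray_last => ->; rewrite addbA.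
  exact: addb_eliminate (eqn c ac bc) (eqn d ad bd).
split=> [a c ac|a b c d eab ecd ac ad bc bd].
  by rewrite /ray_order (upC a c ac); do 2!case: (wind _ _ _); case: (upward _).
have := wind_pair r_gt0 (arc_path eab) (arc_path ecd) (arc_arc eab ecd ac ad bc bd).
rewrite !arc_last // -[X in X = _]addbA (mixed a b) // (mixed c d) 1?eq_sym //.
rewrite /ray_order (upC a c) // (upC a d) // (upC b c) // (upC b d) // addb_regroup.
set x := _ (+) _ (+) (wind (pos b) _ _ (+) _); set y := _ (+) _ (+) (wind (pos d) _ _ (+) _).
by do 4!case: (upward _); case: x; case: y.
Qed.

End ChainDrawing.

(** * From drawings to tournaments *)

Section Topology.
Local Open Scope classical_set_scope.
Local Open Scope ring_scope.

(** [P] is locally constant on [A], so [A] meets it in a relatively open and closed set. *)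
Lemma connected_invariant (X : topologicalType) (A : set X) (N : X -> set X) (P : X -> Prop) a b :
  connected A -> (forall x, A x -> open (N x) /\ N x x) ->
  (forall x y, A x -> A y -> N x y -> P x <-> P y) -> A a -> A b -> P a -> P b.
Proof.
move=> cA nbhN inv Aa Ab Pa; suff : (A `&` P) = A by move/seteqP => -[_ /(_ b Ab)[]].
have opN (Q : X -> Prop) : open (\bigcup_(x in A `&` Q) N x).
  by apply: bigcup_open => x [/nbhN[]].
apply: cA; first by exists a.
  exists (\bigcup_(x in A `&` P) N x) => //; apply/seteqP; split=> x.
    by move=> [Ax Px]; split=> //; exists x => //; have [] := nbhN x Ax.
  by move=> [Ax [y [Ay Py] Nyx]]; split=> //; apply/(inv y x).
exists (~` \bigcup_(x in A `&` (fun x => ~ P x)) N x); first exact: open_closedC.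
apply/seteqP; split=> x.
  by move=> [Ax Px]; split=> // -[y [Ay nPy] Nyx]; apply/nPy/(inv y x).
move=> [Ax nN]; split=> //; apply: contrapT => nPx; apply: nN.
by exists x => //; have [] := nbhN x Ax.
Qed.

Variable R : realType.
Local Notation plane := (R * R)%type.
Implicit Types (A B U : set plane) (x y p q : plane).

Lemma nearby_ball r x y : nearby r x y <-> ball x r y.
Proof. by split=> [/andP[]|[]] => //= ? ?; apply/andP. Qed.

Lemma connected_chain A r p q : 0 < r -> connected A -> A p -> A q ->
  exists s, [/\ path (nearby r) p s, last p s = q & forall x, x \in p :: s -> A x].
Proof.
move=> r0 cA Ap Aq.
pose reach x := exists s, [/\ path (nearby r) p s, last p s = x & forall y, y \in p :: s -> A y].
apply: (@connected_invariant _ _ (ball ^~ r) reach p q cA _ _ Ap Aq).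
- by move=> x _; split; [exact: ball_open | exact: ballxx].
- suff step x y : A y -> ball x r y -> reach x -> reach y.
    by move=> x y Ax Ay xy; split; apply: step => //; apply: ball_sym.
  move=> Ay xy [s [ps lst sA]]; exists (rcons s y); split.
  + by rewrite rcons_path ps lst; apply/nearby_ball.
  + by rewrite last_rcons.
  + by move=> w; rewrite -rcons_cons mem_rcons inE => /orP[/eqP->//|/sA].
- by exists [::]; split=> // x; rewrite inE => /eqP->.
Qed.

Definition segment x y : set plane :=
  (fun t : R => (x.1 + t * (y.1 - x.1), x.2 + t * (y.2 - x.2))) @` `[0, 1].

Lemma segment_cont x y :
  {within `[0, 1], continuous (fun t : R => (x.1 + t * (y.1 - x.1), x.2 + t * (y.2 - x.2)))}.
Proof.
apply: continuous_subspaceT => t.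
have aff (a b : R) : {for t, continuous (fun t : R => a + t * b)}.
  by apply: cvgD; [exact: cvg_cst | apply: cvgM; [exact: cvg_id | exact: cvg_cst]].
exact: cvg_pair (aff _ _) (aff _ _).
Qed.

Lemma segment_l x y : segment x y x.
Proof.
exists 0; first by rewrite /= in_itv /= lexx ler01.
by rewrite !mul0r !addr0; case: x.
Qed.

Lemma segment_r x y : segment x y y.
Proof.
exists 1; first by rewrite /= in_itv /= lexx ler01.
by rewrite !mul1r !subrKC; case: y.
Qed.

Lemma segment_ball x y r : ball x r y -> segment x y `<=` ball x r.
Proof.
have scaled (a b t : R) : 0 <= t <= 1 -> `|a - b| < r -> `|a - (a + t * (b - a))| < r.
  move=> /andP[t0 t1]; apply: le_lt_trans.
  rewrite opprD addNKr normrN normrM (ger0_norm t0) distrC.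
  by rewrite ler_piMl.
move=> [b1 b2] w [t]; rewrite /= in_itv /= => t01 <-.
by split; apply: scaled.
Qed.

Lemma plane_segment_compact x y : compact (segment x y).
Proof. by apply: continuous_compact; [exact: segment_cont | exact: segment_compact]. Qed.

Lemma plane_segment_connected x y : connected (segment x y).
Proof. by apply: connected_continuous_connected; [exact: segment_connected | exact: segment_cont]. Qed.

(** Rays need not be arcs: compactness gives positive distances, connectedness gives chains with
    arbitrarily short steps. *)
Definition continuum A p q := [/\ compact A, connected A, A p & A q].

Lemma continuumU A B p q x : continuum A p q -> continuum B q x -> continuum (A `|` B) p x.
Proof.
move=> [kA cA Ap Aq] [kB cB Bq Bx]; split; [| |by left|by right].
- exact: compactU.
- by apply: connectedU => //; exists q.
Qed.

Lemma segment_continuum x y : continuum (segment x y) x y.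
Proof.
split; [exact: plane_segment_compact|exact: plane_segment_connected|exact: segment_l|exact: segment_r].
Qed.

Lemma continuum_sym A p q : continuum A p q -> continuum A q p.
Proof. by case. Qed.

Lemma open_continuum U p q : open U -> U p -> connected_component U p q ->
  exists2 K, continuum K p q & K `<=` U.
Proof.
move=> oU Up pq.
have Upp : connected_component U p p by exact: connected_component_refl.
(* Radii are chosen at all points; outside [U] the value 1 is a dummy. *)
have rad x : {r : R | 0 < r /\ (U x -> ball x r `<=` U)}.
  apply: cid; have [Ux|nUx] := pselect (U x); last by exists 1.
  have /nbhs_ballP[r r0 sub] : nbhs x U by apply: open_nbhs_nbhs.
  by exists r.
pose reach x := exists2 K, continuum K p x & K `<=` U.
apply: (@connected_invariant plane (connected_component U p)
  (fun x => ball x (sval (rad x))) reach p q) => //.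
- exact: component_connected.
- by move=> x _; case: (rad x) => r [r0 _] /=; split; [exact: ball_open | exact: ballxx].
- move=> x y /connected_component_sub Ux Uy; case: (rad x) => r [r0 /(_ Ux) sub] /= xy.
  have segU : segment x y `<=` U by apply: subset_trans (segment_ball xy) sub.
  have xyK := segment_continuum x y.
  split=> -[K cK KU]; exists (K `|` segment x y); rewrite ?subUset //.
    exact: continuumU cK xyK.
  exact: continuumU cK (continuum_sym xyK).
- exists (segment p p); first exact: segment_continuum.
  by move=> _ [t _ <-]; rewrite !subrr !mulr0 !addr0; case: (p) Up.
Qed.

(** Stated for all small [r], so that finitely many pairs of sets can share one [r]. *)
Lemma compact_apart A B : compact A -> compact B -> A `&` B = set0 ->
  \forall r \near 0^'+, forall x y, A x -> B y -> apart (r + r) x y.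
Proof.
move=> cA cB AB; have clB : closed B by apply: compact_closed cB; exact: norm_hausdorff.
suff : \forall r \near (0:R)^'+, A `<=` [set x | forall y, B y -> apart (r + r) x y].
  by apply: filterS => r sub x y /sub; apply.
move/compact_near_coveringP: cA; apply => x Ax.
have nBx : (~` B) x by move=> Bx; have : (A `&` B) x by []; rewrite AB.
have /nbhs_ballP[d d0 sub] : nbhs x (~` B) by apply: open_nbhs_nbhs; split=> //; exact: closed_openC.
(* A displacement below [d / 4] and a distance below [r + r], itself below [d / 2], add up to less
   than [d]. *)
have d4 : 0 < d / 4 by rewrite divr_gt0.
exists (ball x (d / 4), [set r | r < d / 4]) => /=.
  by split; [exact: nbhsx_ballx | exact: nbhs_right_lt].
move=> [x' r] /= [xx' rd] y By; rewrite /apart !leNgt -negb_and; apply/negP => /andP[c1 c2].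
case: xx' => b1 b2.
have : ball x d y; last by move/sub; apply.
have far (a a' b : R) : `|a - a'| < d / 4 -> `|a' - b| < r + r -> `|a - b| < d.
  rewrite !ltr_norml => /andP[? ?] /andP[? ?]; apply/andP; split; lra.
by split; [exact: far b1 c1 | exact: far b2 c2].
Qed.

Lemma outerplanar_tournament (T : finType) (e : rel T) :
  outerplanar R e -> exists z, even_tournament e z.
Proof.
move=> [pos [arc [F [[pos_inj _ arcP vertexP edgeP] [[q nq ->] _] clF]]]].
have arcK u w : e u w -> continuum (arc u w) (pos u) (pos w).
  move=> /arcP[g [gc _ g0 g1 ->]]; split.
  - by apply: continuous_compact => //; exact: segment_compact.
  - by apply: connected_continuous_connected => //; exact: segment_connected.
  - by exists 0 => //; rewrite /= in_itv /= lexx ler01.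
  - by exists 1 => //; rewrite /= in_itv /= lexx ler01.
have arc_closed u w : e u w -> closed (arc u w).
  by move=> /arcK[cA _ _ _]; apply: compact_closed cA; exact: norm_hausdorff.
have arcs_closed (Q : pred (T * T)) : (forall uw, Q uw -> e uw.1 uw.2) ->
    closed (\bigcup_(uw in [set uw | Q uw]) arc uw.1 uw.2).
  by move=> Qe; apply: closed_bigcup => [|uw /Qe /arc_closed//]; exact: finite_finset.
set D := drawn_set e pos arc in nq clF *.
have open_D : open (~` D).
  apply: closed_openC; apply: closedU; last exact: (arcs_closed (fun uw => e uw.1 uw.2)).
  rewrite -bigcup_imset1; apply: closed_bigcup => [|v _]; first exact: finite_finset.
  by apply: compact_closed (@compact_set1 _ _); exact: norm_hausdorff.
(* Some ball around [pos v] misses all arcs not incident with [v], and it contains a point [v'] of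
   the face. A continuum in the face leads from [q] to [v'], and a segment inside the ball leads on
   to [pos v]. *)
have rays v : exists G, continuum G q (pos v) /\
    forall u w, e u w -> u != v -> w != v -> arc u w `&` G = set0.
  pose far (uw : T * T) := [&& e uw.1 uw.2, uw.1 != v & uw.2 != v].
  have clA : closed (\bigcup_(uw in [set uw | far uw]) arc uw.1 uw.2).
    by apply: arcs_closed => uw /andP[].
  have /nbhs_ballP[r /= r0 sub] : nbhs (pos v) (~` \bigcup_(uw in [set uw | far uw]) arc uw.1 uw.2).
    apply: open_nbhs_nbhs; split; first exact: closed_openC.
    move=> [[u w] /= /and3P[/= euw uv wv]] /(vertexP _ _ _ euw)[] E; first by rewrite E eqxx in uv.
    by rewrite E eqxx in wv.
  have [v' [Fv' vv']] := clF v _ (nbhsx_ballx (pos v) r r0).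
  have [K cK KD] := open_continuum open_D nq Fv'.
  exists (K `|` segment (pos v) v'); split.
    exact: continuumU cK (continuum_sym (segment_continuum _ _)).
  move=> u w euw uv wv; apply/seteqP; split=> // x [xA [/KD nD|xS]].
    by apply: nD; right; exists (u, w).
  by case: (sub x); [exact: segment_ball vv' _ xS | exists (u, w) => //; apply/and3P].
have [ray rayP] := choice rays.
have rayK v : continuum (ray v) q (pos v) by have [] := rayP v.
(* A common point would be the position of a vertex, which would be an end of both edges. *)
have disjoint_arcs a b c d : e a b -> e c d -> a != c -> a != d -> b != c -> b != d ->
    arc a b `&` arc c d = set0.
  move=> eab ecd ac ad bc bd; apply/seteqP; split=> // x [xab xcd].
  have neq : [set a; b]%SET != [set c; d]%SET.
    by apply/eqP => /setP/(_ a); rewrite !inE eqxx (negPf ac) (negPf ad).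
  have [v _ vx] := edgeP _ _ _ _ eab ecd neq x (conj xab xcd).
  rewrite -vx in xab xcd.
  by case: (vertexP _ _ _ eab xab) => va; case: (vertexP _ _ _ ecd xcd) => vc;
    move: ac ad bc bd; rewrite -va -vc eqxx.
have near_arcs : \forall r \near (0 : R)^'+, forall i : T * T * (T * T),
    let: (a, b, (c, d)) := i in
    e a b -> e c d -> a != c -> a != d -> b != c -> b != d ->
    forall x y, arc a b x -> arc c d y -> apart (r + r) x y.
  apply: filter_forall => -[[a b] [c d]].
  have [/and5P[/andP[eab ecd] ac ad bc bd]|h] :=
      boolP [&& e a b && e c d, a != c, a != d, b != c & b != d].
    have [kA _ _ _] := arcK _ _ eab; have [kB _ _ _] := arcK _ _ ecd.
    have := compact_apart kA kB (disjoint_arcs _ _ _ _ eab ecd ac ad bc bd).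
    by apply: filterS => r rP.
  apply: nearW => r eab ecd ac ad bc bd.
  by case/negP: h; rewrite eab ecd ac ad bc bd.
have near_rays : \forall r \near (0 : R)^'+, forall i : T * T * T,
    let: (a, b, c) := i in e a b -> a != c -> b != c ->
    forall x y, arc a b x -> ray c y -> apart (r + r) x y.
  apply: filter_forall => -[[a b] c].
  have [/and3P[eab ac bc]|h] := boolP [&& e a b, a != c & b != c].
    have [kA _ _ _] := arcK _ _ eab; have [kB _ _ _] := rayK c.
    have := compact_apart kA kB ((rayP c).2 _ _ eab ac bc).
    by apply: filterS => r rP.
  by apply: nearW => r eab ac bc; case/negP: h; rewrite eab ac bc.
have [r [r0 [arcs_apart rays_apart]]] :=
  filter_ex (filterI (nbhs_right_gt 0) (filterI near_arcs near_rays)).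
have arc_chain (i : T * T) : exists s, e i.1 i.2 ->
    [/\ path (nearby r) (pos i.1) s, last (pos i.1) s = pos i.2 &
    forall x, x \in pos i.1 :: s -> arc i.1 i.2 x].
  have [/arcK[_ cA pA qA]|] := boolP (e i.1 i.2); last by exists [::].
  by have [s sP] := connected_chain r0 cA pA qA; exists s.
have [arcs arcsP] := choice arc_chain.
have ray_chain v : exists s, [/\ path (nearby r) q s, last q s = pos v &
    forall x, x \in q :: s -> ray v x].
  by have [_ cA pA qA] := rayK v; exact: connected_chain.
have [chains chainsP] := choice ray_chain.
exists (ray_order pos q chains).
apply: (@ray_order_even _ _ _ pos (fun a b => arcs (a, b)) q chains r) => //.
- by move=> a b /(arcsP (a, b))[].
- by move=> a b /(arcsP (a, b))[].
- by move=> a; have [] := chainsP a.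
- by move=> a; have [] := chainsP a.
- move=> a b c d eab ecd ac ad bc bd x y xs ys.
  have [_ _ sub] := arcsP (a, b) eab; have [_ _ sub'] := arcsP (c, d) ecd.
  exact: (arcs_apart (a, b, (c, d))) eab ecd ac ad bc bd _ _ (sub _ xs) (sub' _ ys).
- move=> a b c eab ac bc x y xs ys.
  have [_ _ sub] := arcsP (a, b) eab; have [_ _ sub'] := chainsP c.
  exact: (rays_apart (a, b, c)) eab ac bc _ _ (sub _ xs) (sub' _ ys).
Qed.

End Topology.

(** * The conflict-free colouring with four colours *)

Lemma CFON_colorable4 (T : finType) (e : rel T) (F : T -> color * color) :
  (forall v, witnesses e F [set: T]%SET v = 1%N) -> CFON_colorable e 4.
Proof.
move=> F1; have card_color : #|{: color}| = 4 by rewrite card_prod card_bool.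
pose C c : 'I_4 := cast_ord card_color (enum_rank c).
have C_inj : injective C by move=> c d /cast_ord_inj/enum_rank_inj.
apply/existsP; exists [ffun v => C (F v).1].
apply/forallP => v; apply/existsP; exists (C (F v).2).
apply/eqP; apply: etrans (F1 v); apply: eq_card => w.
by rewrite !inE ffunE (inj_eq C_inj).
Qed.

Theorem theorem22 (R : realType) (T : finType) (e : rel T)
  (e_sym : symmetric e) (e_irr : irreflexive e)
  (e_conn : connected_graph e) (e_niso : no_isolated_vertex e)
  (e_outer : outerplanar R e) :
  (chi_ON e_niso <= 4)%N.
Proof.
have [z zP] := outerplanar_tournament e_outer.
have [F F1] := tournament_witnesses e_sym e_irr zP e_conn e_niso.
by rewrite /chi_ON; case: ex_minnP => m _; apply; apply: CFON_colorable4 F1.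
Qed.
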